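(* For every $0\le n\le N$, $m\ge1$ and $x>0$, $\bar V^{[m]}_n(x)\le V^{[m]}_n(x)$, and for every $0\le n\le N$, $m\ge1$, $x^{[m]*}_n\le\bar x^{[m]*}_n$; equivalently, the exercise region of the random-maturity option contains that of the fixed-maturity option: $D^{[m]}_n\subseteq\bar D^{[m]}_n$.
   Context: Let $r\ge0$, $\alpha:=(1+r)^{-1}$, and $\lambda>1$ with $\lambda^{-1}<1+r<\lambda$. Put $p:=\frac{(1+r)-\lambda^{-1}}{\lambda-\lambda^{-1}}$, $q:=1-p$ (both in $(0,1)$). Let $K>0$, $g(x):=(K-x)^+$ for $x>0$, and $(\mathcal A\varphi)(x):=\alpha[p\,\varphi(\lambda x)+q\,\varphi(\lambda^{-1}x)]$ for functions $\varphi$ on $(0,\infty)$. Fixed maturity: $V^{[0]}_n\equiv0$, $V^{[m]}_0=g$ ($m\ge1$), $V^{[m]}_n=\max\{g+\mathcal AV^{[m-1]}_{n-1},\ \mathcal AV^{[m]}_{n-1}\}$ ($n,m\ge1$); $\Delta V^{[m]}_n:=V^{[m]}_n-V^{[m-1]}_n$; $f^{[m]}_n:=\mathcal A\Delta V^{[m]}_{n-1}$ ($n\ge1$), $f^{[m]}_0:=0$; $D^{[m]}_n:=\{x\in(0,K]:g(x)\ge f^{[m]}_n(x)\}$, $x^{[m]*}_n:=\sup D^{[m]}_n$. Random maturity: $\widetilde N$ is a random variable with values in $\{0,\dots,N\}$, independent of the price process, with $\mathrm P(\widetilde N=N)>0$; for $1\le n\le N$, $\pi_{n-1}:=\mathrm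 P(\widetilde N\ge N-n+1\mid\widetilde N\ge N-n)$ and $\mathcal A_n:=\pi_{n-1}\mathcal A$. $\bar V^{[0]}_n\equiv0$, $\bar V^{[m]}_0=g$ ($m\ge1$), $\bar V^{[m]}_n=\max\{g+\mathcal A_n\bar V^{[m-1]}_{n-1},\ \mathcal A_n\bar V^{[m]}_{n-1}\}$ ($1\le n\le N$, $m\ge1$); $\Delta\bar V^{[m]}_n:=\bar V^{[m]}_n-\bar V^{[m-1]}_n$; $\bar f^{[m]}_n:=\mathcal A_n\Delta\bar V^{[m]}_{n-1}$ ($n\ge1$), $\bar f^{[m]}_0:=0$; $\bar D^{[m]}_n:=\{x\in(0,K]:g(x)\ge\bar f^{[m]}_n(x)\}$, $\bar x^{[m]*}_n:=\sup\bar D^{[m]}_n$. *)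

(* Defs.v *)
From HB Require Import structures.
From mathcomp Require Import all_boot all_order all_algebra.
From mathcomp Require Import all_classical all_reals all_analysis.

Set Implicit Arguments.
Unset Strict Implicit.
Unset Printing Implicit Defensive.

Import Order.TTheory GRing.Theory Num.Theory.

Local Open Scope classical_set_scope.
Local Open Scope ring_scope.

Section Option.
Context {R : realType}.

Definition discount (r : R) : R := (1 + r)^-1.

Definition up_prob (r lam : R) : R := ((1 + r) - lam^-1) / (lam - lam^-1).

Definition put_payoff (K : R) (x : R) : R := Num.max (K - x) 0.

(* Functions on (0, +oo) are represented by total functions R -> R: for
   0 < x, the operator only evaluates phi at positive points. *)
Definition pricing_op (r lam : R) (phi : R -> R) (x : R) : R :=
  let p := up_prob r lam in
  discount r * (p * phi (lam * x) + (1 - p) * phi (lam^-1 * x)).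

(* A n is the operator used in the step from n - 1 to n remaining periods;
   A 0 is never used. *)
Fixpoint value (g : R -> R) (A : nat -> (R -> R) -> R -> R) (m n : nat)
    {struct n} : R -> R :=
  match m, n with
  | 0%N, _ => fun=> 0
  | _.+1, 0%N => g
  | m'.+1, n'.+1 => fun x =>
      Num.max (g x + A n (value g A m' n') x) (A n (value g A m n') x)
  end.

(* m.-1 is the genuine predecessor only for m >= 1. *)
Definition value_diff (g : R -> R) (A : nat -> (R -> R) -> R -> R)
    (m n : nat) (x : R) : R :=
  value g A m n x - value g A m.-1 n x.

Definition continuation (g : R -> R) (A : nat -> (R -> R) -> R -> R)
    (m n : nat) : R -> R :=
  if n is n'.+1 then A n (value_diff g A m n') else fun=> 0.

Definition exercise_region (K : R) (A : nat -> (R -> R) -> R -> R)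
    (m n : nat) : set R :=
  [set x | 0 < x <= K /\
           continuation (put_payoff K) A m n x <= put_payoff K x].

Definition exercise_boundary (K : R) (A : nat -> (R -> R) -> R -> R)
    (m n : nat) : R :=
  sup (exercise_region K A m n).

Definition fixed_op (r lam : R) (_ : nat) : (R -> R) -> R -> R :=
  pricing_op r lam.

End Option.

Section RandomMaturity.
Context {R : realType} {d : measure_display} {T : measurableType d}.
Variable P : probability T R.

Definition cond_prob (A B : set T) : R := fine (P (A `&` B)) / fine (P B).

(* survival_prob N Nt n is pi_(n-1), for 1 <= n <= N; the truncated
   subtraction is exact in this range. *)
Definition survival_prob (N : nat) (Nt : T -> nat) (n : nat) : R :=
  cond_prob [set w | (N - n + 1 <= Nt w)%N] [set w | (N - n <= Nt w)%N].

Definition random_op (r lam : R) (N : nat) (Nt : T -> nat) (n : nat)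
    (phi : R -> R) (x : R) : R :=
  survival_prob N Nt n * pricing_op r lam phi x.

(* S_0, ..., S_N is a binomial tree started at s0 whose N moves are independent,
   by lam with probability p and by lam^-1 with probability 1 - p: every pattern
   u of moves has the product probability. *)
Definition binomial_price_process (lam p s0 : R) (N : nat)
    (S : nat -> {RV P >-> R}) : Prop :=
  (forall w, S 0%N w = s0) /\
  forall u : {ffun 'I_N -> bool},
    P [set w | forall k : 'I_N,
                 S k.+1 w = (if u k then lam else lam^-1) * S k w] =
    (\prod_(k < N) (if u k then p else 1 - p))%:E.

(* Independence of Nt and sigma(S_0, ..., S_N), tested on the generating
   pi-systems of singletons and of measurable cylinders. *)
Definition indep_of_process (N : nat) (Nt : {RV P >-> nat})
    (S : nat -> {RV P >-> R}) : Prop :=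
  forall (j : nat) (B : nat -> set R), (forall k, measurable (B k)) ->
    let C := [set w | forall k, (k <= N)%N -> B k (S k w)] in
    P ([set w | Nt w = j] `&` C) = (P [set w | Nt w = j] * P C)%E.

End RandomMaturity.

(* Main.v *)
Require Import Defs.
From mathcomp Require Import all_boot all_order all_algebra.
From mathcomp Require Import all_classical all_reals all_analysis.
From mathcomp Require Import ring lra.
Import Order.TTheory GRing.Theory Num.Theory.
Local Open Scope classical_set_scope.
Local Open Scope ring_scope.

(** The continuation values [f m] of a swing option are nonincreasing in the
    number [m] of exercise rights. Under this monotonicity the recursion for
    the marginal values becomes
    [dV m.+1 n = min (f m n) (max g (f m.+1 n))] (without the [min] for the
    first right), which is nondecreasing in the continuation values. Since
    [pi_(n-1) <= 1], induction on [n] shows that random maturity lowers every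
    marginal value and every continuation value, pointwise; summing over the
    rights lowers the value, and a lower continuation value enlarges the
    exercise region. *)

(** Differences are the form needed for marginal values; [phi = psi] also yields that the zero
    function is sent to 0. *)
Definition additive_op {R : realType} (A : nat -> (R -> R) -> R -> R) : Prop :=
  forall n phi psi x,
    A n (fun y => phi y - psi y) x = A n phi x - A n psi x.

Definition monotone_op {R : realType} (A : nat -> (R -> R) -> R -> R) : Prop :=
  forall n phi psi, (forall y, phi y <= psi y) ->
    forall x, A n phi x <= A n psi x.

Lemma additive_op0 {R : realType} {A : nat -> (R -> R) -> R -> R} :
  additive_op A -> forall n x, A n (fun=> 0) x = 0.
Proof.
move=> AB n x; have -> : (fun=> 0) = (fun=> 0 - 0) :> (R -> R).
  by apply/funext => y; rewrite subrr.
by rewrite AB subrr.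
Qed.

Lemma value0 {R : realType} (g : R -> R) (A : nat -> (R -> R) -> R -> R)
    (n : nat) : value g A 0 n = fun=> 0.
Proof. by case: n. Qed.

(** By additivity both branches of the recursion share the value of the remaining [m] rights; what
    is left is the choice of exercising one right or keeping it. *)
Lemma value_max {R : realType} (g : R -> R) (A : nat -> (R -> R) -> R -> R)
    (m n : nat) (x : R) : additive_op A ->
  value g A m.+1 n.+1 x =
  A n.+1 (value g A m n) x + Num.max (g x) (continuation g A m.+1 n.+1 x).
Proof.
move=> AB; rewrite /= /value_diff /= AB addr_maxr.
by congr Num.max; ring.
Qed.

Lemma value_diff_first {R : realType} (g : R -> R)
    (A : nat -> (R -> R) -> R -> R) (n : nat) (x : R) : additive_op A ->
  value_diff g A 1 n.+1 x = Num.max (g x) (continuation g A 1 n.+1 x).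
Proof.
move=> AB; rewrite /value_diff value_max // value0.
by rewrite additive_op0 // add0r value0 subr0.
Qed.

(** With [f1], [f2] the continuation values for [m.+1], [m.+2], subtracting two instances of
    [value_max] gives [f1 + max g f2 - max g f1]. As [f2 <= f1], this is [f2], [g] or [f1] according
    to whether [g] lies below, between or above them. *)
Lemma value_diff_next {R : realType} (g : R -> R)
    (A : nat -> (R -> R) -> R -> R) (m n : nat) (x : R) : additive_op A ->
  continuation g A m.+2 n.+1 x <= continuation g A m.+1 n.+1 x ->
  value_diff g A m.+2 n.+1 x =
  Num.min (continuation g A m.+1 n.+1 x)
          (Num.max (g x) (continuation g A m.+2 n.+1 x)).
Proof.
move=> AB f21; rewrite {1}/value_diff !value_max //.
have fE : continuation g A m.+1 n.+1 x =
    A n.+1 (value g A m.+1 n) x - A n.+1 (value g A m n) x by rewrite /= AB.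
move: f21 fE; set f2 := continuation _ _ m.+2 _ _.
set f1 := continuation _ _ m.+1 _ _ => f21 fE.
case: (leP (g x) f2) => ?; case: (leP (g x) f1) => ?; try lra.
(* Only [g <= f2 <= f1] is left: there the min compares [f1] with [f2]. *)
by rewrite min_r; lra.
Qed.

Lemma continuation_le {R : realType} (g : R -> R)
    (A : nat -> (R -> R) -> R -> R) (m n : nat) : monotone_op A ->
  (forall y, value_diff g A m.+2 n y <= value_diff g A m.+1 n y) ->
  forall x, continuation g A m.+2 n.+1 x <= continuation g A m.+1 n.+1 x.
Proof. by move=> Ale dle x; exact: Ale. Qed.

(** A continuation value separates consecutive marginal values: [dV m.+2 <= f m.+1 <= dV m.+1], the
    second inequality using [f m.+1 <= f m] from the induction hypothesis. *)
Lemma value_diff_decr {R : realType} (g : R -> R)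
    (A : nat -> (R -> R) -> R -> R) (m n : nat) (x : R) :
  (forall y, 0 <= g y) -> additive_op A -> monotone_op A ->
  value_diff g A m.+2 n x <= value_diff g A m.+1 n x.
Proof.
move=> g0 AB Ale; elim: n m x => [|n IH] m x.
  (* At maturity the first right is worth [g] and every further one 0. *)
  by rewrite /value_diff; case: m => [|m] /=; rewrite ?subrr ?subr0.
have fle k : continuation g A k.+2 n.+1 x <= continuation g A k.+1 n.+1 x.
  by apply: continuation_le => // y; exact: IH.
rewrite value_diff_next //; apply: (@le_trans _ _ (continuation g A m.+1 n.+1 x)).
  by rewrite ge_min lexx.
case: m => [|m]; first by rewrite value_diff_first // le_max lexx orbT.
by rewrite value_diff_next // le_min fle le_max lexx orbT.
Qed.

(** This makes marginal values admissible in the comparison of two operators, which is assumed on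
    nonnegative functions only. *)
Lemma value_diff_ge0 {R : realType} (g : R -> R)
    (A : nat -> (R -> R) -> R -> R) (m n : nat) (x : R) :
  (forall y, 0 <= g y) -> additive_op A -> monotone_op A ->
  0 <= value_diff g A m.+1 n x.
Proof.
move=> g0 AB Ale; elim: n m x => [|n IH] m x.
  by rewrite /value_diff; case: m => [|m] /=; rewrite ?subrr ?subr0.
have f0 k : 0 <= continuation g A k.+1 n.+1 x.
  by rewrite -(additive_op0 AB n.+1 x); apply: Ale => y; exact: IH.
case: m => [|m]; first by rewrite value_diff_first // le_max g0.
rewrite value_diff_next ?le_min ?f0 ?le_max ?g0 //.
by apply: continuation_le => // y; exact: value_diff_decr.
Qed.

Section Comparison.
Context {R : realType} {g : R -> R} {A B : nat -> (R -> R) -> R -> R}.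
Context (g0 : forall y, 0 <= g y).
Context (AB : additive_op A) (Ale : monotone_op A).
Context (BB : additive_op B) (Ble : monotone_op B).
Context (BA : forall n phi, (forall y, 0 <= phi y) ->
                forall x, B n phi x <= A n phi x).

Lemma continuation_le_op (m n : nat) (x : R) :
  (forall y, value_diff g B m.+1 n y <= value_diff g A m.+1 n y) ->
  continuation g B m.+1 n.+1 x <= continuation g A m.+1 n.+1 x.
Proof.
(* Change the operator first, at the nonnegative marginal value of [B], then its argument. *)
move=> dle; apply: (@le_trans _ _ (A n.+1 (value_diff g B m.+1 n) x)).
  by apply: BA => y; exact: value_diff_ge0.
exact: Ale.
Qed.

Lemma value_diff_le_op (m n : nat) (x : R) :
  value_diff g B m.+1 n x <= value_diff g A m.+1 n x.
Proof.
elim: n m x => [|n IH] m x; first by case: m.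
have fle k : continuation g B k.+1 n.+1 x <= continuation g A k.+1 n.+1 x.
  by apply: continuation_le_op => y; exact: IH.
case: m => [|m].
  by rewrite !value_diff_first // ge_max !le_max lexx fle orbT.
rewrite !value_diff_next //; first last.
- by apply: continuation_le => // y; exact: value_diff_decr.
- by apply: continuation_le => // y; exact: value_diff_decr.
(* The two minima are compared argument by argument. *)
rewrite le_min !ge_min fle; apply/orP; right.
by rewrite ge_max !le_max lexx fle orbT.
Qed.

Lemma value_le_op (m n : nat) (x : R) : value g B m n x <= value g A m n x.
Proof.
elim: m => [|m IH]; first by rewrite !value0.
by have := value_diff_le_op m n x; rewrite /value_diff /=; lra.
Qed.

End Comparison.

Lemma exercise_region_le_op {R : realType} (K : R)
    (A B : nat -> (R -> R) -> R -> R) (m n : nat) :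
  (forall x, continuation (put_payoff K) B m n x <=
             continuation (put_payoff K) A m n x) ->
  exercise_region K A m n `<=` exercise_region K B m n.
Proof. by move=> fle x [xK fg]; split=> //; exact: le_trans fg. Qed.

Lemma exercise_boundary_le_op {R : realType} (K : R)
    (A B : nat -> (R -> R) -> R -> R) (m n : nat) :
  exercise_region K A m n `<=` exercise_region K B m n ->
  exercise_boundary K A m n <= exercise_boundary K B m n.
Proof.
move=> sub; have ubB : has_ubound (exercise_region K B m n).
  by exists K => x [/andP[_ xK] _].
(* The supremum of the empty set is 0 by convention, which stays below the other boundary because
   regions contain only positive points. *)
have [D0|/set0P[x Dx]] := eqVneq (exercise_region K A m n) set0.
  rewrite /exercise_boundary D0 sup0.
  have [->|/set0P[x Bx]] := eqVneq (exercise_region K B m n) set0.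
    by rewrite sup0.
  have [/andP[/ltW x0 _] _] := Bx.
  by apply: (le_trans x0); exact: ub_le_sup.
apply: ge_sup; first by exists x.
by move=> y /sub; exact: ub_le_sup.
Qed.

Lemma up_prob_itv {R : realType} (r lam : R) :
  1 < lam -> lam^-1 < 1 + r -> 1 + r < lam -> 0 <= up_prob r lam <= 1.
Proof.
move=> lam1 low up; have d0 : 0 < lam - lam^-1 by rewrite subr_gt0 (lt_trans low).
by rewrite /up_prob divr_ge0 ?ler_pdivrMr ?mul1r //=; lra.
Qed.

Lemma pricing_opB {R : realType} (r lam : R) (phi psi : R -> R) (x : R) :
  pricing_op r lam (fun y => phi y - psi y) x =
  pricing_op r lam phi x - pricing_op r lam psi x.
Proof. by rewrite /pricing_op; ring. Qed.

Lemma pricing_op_le {R : realType} (r lam : R) (phi psi : R -> R) (x : R) :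
  0 <= r -> 0 <= up_prob r lam <= 1 -> (forall y, phi y <= psi y) ->
  pricing_op r lam phi x <= pricing_op r lam psi x.
Proof.
move=> r0 /andP[p0 p1] le; rewrite /pricing_op /discount.
by rewrite ler_wpM2l ?invr_ge0 ?addr_ge0 // lerD // ler_wpM2l // subr_ge0.
Qed.

Lemma cond_prob_itv {R : realType} {d : measure_display} {T : measurableType d}
    (P : probability T R) (A B : set T) :
  measurable A -> measurable B -> 0 <= cond_prob P A B <= 1.
Proof.
move=> mA mB; have fP C : measurable C -> P C \is a fin_num.
  by move=> mC; exact: fin_num_measure.
have mAB : measurable (A `&` B) by exact: measurableI.
rewrite /cond_prob divr_ge0 ?fine_ge0 //=.
(* Conditioning on a null event gives 0, since the inverse of 0 is 0. *)
have [->|B0] := eqVneq (fine (P B)) 0; first by rewrite invr0 mulr0.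
rewrite ler_pdivrMr ?mul1r; last by rewrite lt_def B0 fine_ge0.
by apply: fine_le; rewrite ?fP //; apply: le_measure; rewrite ?inE.
Qed.

Lemma survival_prob_itv {R : realType} {d : measure_display}
    {T : measurableType d} (P : probability T R) (N : nat) (Nt : {RV P >-> nat})
    (n : nat) : 0 <= survival_prob P N Nt n <= 1.
Proof.
have mNt k : measurable [set w | (k <= Nt w)%N].
  exact: (measurable_funPTI Nt (Y := [set j | (k <= j)%N])).
exact: cond_prob_itv.
Qed.

Theorem corollary4p5 (R : realType) (r lam K s0 : R) (N : nat)
    (d : measure_display) (T : measurableType d) (P : probability T R)
    (S : nat -> {RV P >-> R}) (Nt : {RV P >-> nat})
    (hr : 0 <= r) (hlam : 1 < lam) (hlow : lam^-1 < 1 + r) (hup : 1 + r < lam)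
    (hK : 0 < K) (hs0 : 0 < s0)
    (hS : binomial_price_process lam (up_prob r lam) s0 N S)
    (hNt : forall w, (Nt w <= N)%N)
    (hindep : indep_of_process N Nt S)
    (hpos : (0 < P [set w | Nt w = N])%E) :
  let A := fixed_op r lam in
  let Abar := random_op P r lam N Nt in
  let g := put_payoff K in
  [/\ forall (n m : nat) (x : R), (n <= N)%N -> (1 <= m)%N -> 0 < x ->
        value g Abar m n x <= value g A m n x,
      forall n m : nat, (n <= N)%N -> (1 <= m)%N ->
        exercise_boundary K A m n <= exercise_boundary K Abar m n
    & forall n m : nat, (n <= N)%N -> (1 <= m)%N ->
        exercise_region K A m n `<=` exercise_region K Abar m n].
Proof.
move=> A Abar g.
have p01 := up_prob_itv _ _ hlam hlow hup.
have g0 y : 0 <= g y by rewrite le_max lexx orbT.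
have AB : additive_op A by move=> n phi psi x; exact: pricing_opB.
have Ale : monotone_op A by move=> n phi psi le x; exact: pricing_op_le.
have BB : additive_op Abar.
  by move=> n phi psi x; rewrite /Abar /random_op pricing_opB mulrBr.
have pi01 n := survival_prob_itv P N Nt n.
have Ble : monotone_op Abar.
  move=> n phi psi le x; have /andP[pi0 _] := pi01 n.
  by rewrite ler_wpM2l // pricing_op_le.
have BA n phi : (forall y, 0 <= phi y) -> forall x, Abar n phi x <= A n phi x.
  move=> phi0 x; have /andP[_ pi1] := pi01 n; rewrite ler_piMl //.
  (* A factor at most 1 lowers only nonnegative numbers; [A n phi x] is one, by monotonicity from
     the zero function. *)
  by rewrite -(additive_op0 AB n x); exact: Ale.
have sub n m : (1 <= m)%N ->
    exercise_region K A m n `<=` exercise_region K Abar m n.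
  case: m => // m _; apply: exercise_region_le_op => x.
  (* For [n = 0] both continuation values are 0 by definition. *)
  case: n => // n; apply: continuation_le_op => // y; exact: value_diff_le_op.
split=> [n m x _ _ _|n m _ m1|n m _ m1]; last exact: sub.
  exact: value_le_op.
exact/exercise_boundary_le_op/sub.
Qed.
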